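(* Let $n$ be a positive integer. Define a double-indexed sequence $V_r(k)$ (integers $r\ge 0$, $k\ge 0$) by $V_r(0)=1$ for all $r$ and, for $k\ge 1$, $$V_r(k)=2\,(n-r-k)\,V_r(k-1)-2\,(n-2r-\delta(n-1))\,V_{r+1}(k-1).$$ Then $$\frac{V_0(\lfloor n/2\rfloor)}{(n-1)(n-2)\cdots(n-\lfloor n/2\rfloor)}=\begin{cases}+2 & n\equiv 0 \pmod 8\\ +1 & n\equiv\pm1\pmod 8\\ 0 & n\equiv\pm2\pmod 8\\ -1 & n\equiv\pm3\pmod 8\\ -2 & n\equiv \pm 4\pmod 8.\end{cases}$$
   Context: For an integer $m\ge 0$, $\delta(m)\in\{0,1\}$ is the residue of $m$ modulo $2$. The denominator is $\prod_{j=1}^{\lfloor n/2\rfloor}(n-j)$; an empty product equals $1$. *)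

(* Defs.v *)
From mathcomp Require Import all_boot all_order all_algebra.
Set Implicit Arguments.
Unset Strict Implicit.
Unset Printing Implicit Defensive.
Import GRing.Theory.
Local Open Scope ring_scope.

Definition delta (m : nat) : nat := (m %% 2)%N.

(* The subtractions [n - r - k] and [n - 2 * r - _] are taken in [int]: they
   are negative for large [r] and [k]. The natural subtraction [n.-1] is harmless
   for positive [n]. *)
Fixpoint V (n r k : nat) {struct k} : int :=
  match k with
  | 0%N => 1
  | k'.+1 =>
      2 * (n%:Z - r%:Z - k%:Z) * V n r k'
      - 2 * (n%:Z - 2 * r%:Z - (delta n.-1)%:Z) * V n r.+1 k'
  end.

(* Main.v *)
Require Import Defs.
From mathcomp Require Import all_boot all_order all_algebra.
From mathcomp Require Import zify ring.
Import GRing.Theory.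
Local Open Scope ring_scope.

(** The recurrence is a weighted count of lattice paths: a step from [(r, k)]
either keeps [r] and lowers [k], with weight [2 (n - r - k)], or raises [r] and
lowers [k], with weight [- 2 (n - 2 r - delta (n - 1))].  The first weight
depends only on [r + k], which a raising step leaves unchanged, and the second
only on [r]; so all paths with [j] raising steps have the same weight
([path_sum]), and [V n 0 k] is a sum over [j] of [k] choose [j] products.

For [k = n / 2] the odd factors [n - 2 i - delta (n - 1)] interleave with the
even factors of [2 ^ j * k ^_ j] into the falling factorial [n ^_ (2 j)]
([even_odd_ffact]).  Dividing by [(n - 1) ... (n - k)] therefore leaves
[(-1) ^ j 2 ^ (k - j) n / (n - j) * 'C(n - j, j)], that is, the terms of the
Lucas polynomial [x ^ n + y ^ n], where [x y = 1] and [(x + y) ^ 2 = 2], divided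
by [x + y] for odd [n].  Here [x] and [y] are primitive eighth roots of unity,
whence the period 8.

To stay inside the integers, the Lucas numbers are written as
[fib2 n - fib2 (n - 2)], where [fib2] is the Fibonacci companion; Pascal's rule
gives its recurrence ([fib2_rec]), hence [fib2 (n + 4) = - fib2 n], and the
values follow from the first ones. *)

(** * Path sums *)

(** A product of [j] weights [b] and [k - j] weights [a] is attached to each
choice of the [j] raising steps among [k].  The induction on [k] peels the first
step, as in the binomial theorem. *)
Lemma path_sum (R : comPzRingType) (a b : nat -> R) (W : nat -> nat -> R) :
    (forall r, W r 0 = 1) ->
    (forall r k, W r k.+1 = a (r + k.+1)%N * W r k + b r * W r.+1 k) ->
  forall k r, W r k =
    \sum_(j < k.+1)
      ((\prod_(0 <= i < j) b (r + i)%N) * \prod_(j <= i < k) a (r + i.+1)%N)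
        *+ 'C(k, j).
Proof.
move=> W0 WS; elim=> [|k IHk] r.
  by rewrite W0 big_ord1 !big_geq // mulr1 bin0.
pose t j := (\prod_(0 <= i < j) b (r + i)%N) *
  \prod_(j <= i < k.+1) a (r + i.+1)%N.
have keep : a (r + k.+1)%N * W r k = \sum_(j < k.+2) t j *+ 'C(k, j).
  rewrite IHk [RHS]big_ord_recr /= bin_small // mulr0n addr0 mulr_sumr.
  apply: eq_bigr => j _; rewrite mulrnAr /t [in RHS]big_nat_recr /=; last first.
    by rewrite -ltnS.
  by congr (_ *+ _); ring.
have raise : b r * W r.+1 k = \sum_(j < k.+1) t j.+1 *+ 'C(k, j).
  rewrite IHk mulr_sumr; apply: eq_bigr => j _; rewrite mulrnAr /t.
  rewrite [in RHS]big_nat_recl // big_add1 /= addn0 -!mulrA.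
  congr (b r * (_ * _) *+ _); apply: eq_bigr => i _.
    by rewrite addSnnS.
  by rewrite addSnnS.
rewrite WS keep raise big_ord_recl [RHS]big_ord_recl !bin0 -addrA.
by congr (_ + _); rewrite -big_split /=; apply: eq_bigr => j _; rewrite binS mulrnDr.
Qed.

(** * The terms of the path sum *)

Lemma even_odd_step (n j : nat) : (0 < n)%N -> (j < n %/ 2)%N ->
  2 * ((n %/ 2)%:Z - j%:Z) * (n%:Z - 2 * j%:Z - (delta n.-1)%:Z) =
  (n - j.*2)%:Z * (n - j.*2.+1)%:Z.
Proof.
rewrite /delta => n_gt0 j_lt.
have [nE | nE] : n = (n %/ 2).*2 \/ n = (n %/ 2).*2.+1 by lia.
  have -> : (n.-1 %% 2)%N = 1%N by lia.
  have -> : (n - j.*2)%:Z = 2 * ((n %/ 2)%:Z - j%:Z) by lia.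
  have -> : (n - j.*2.+1)%:Z = n%:Z - 2 * j%:Z - 1 by lia.
  by [].
have -> : (n.-1 %% 2)%N = 0%N by lia.
have -> : (n - j.*2.+1)%:Z = 2 * ((n %/ 2)%:Z - j%:Z) by lia.
have -> : (n - j.*2)%:Z = n%:Z - 2 * j%:Z by lia.
by ring.
Qed.

(** One of [2 (n / 2 - i)] and [n - 2 i - delta (n - 1)] is [n - 2 i] and the
other [n - 2 i - 1], in an order that depends on the parity of [n]. *)
Lemma even_odd_ffact (n j : nat) : (0 < n)%N -> (j <= n %/ 2)%N ->
  2 ^+ j * ((n %/ 2) ^_ j)%:Z *
    \prod_(0 <= i < j) (n%:Z - 2 * i%:Z - (delta n.-1)%:Z) = (n ^_ j.*2)%:Z.
Proof.
move=> n_gt0; elim: j => [|j IHj] j_lt; first by rewrite big_geq // !ffactn0.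
rewrite big_nat_recr //= doubleS !ffactnSr exprS !PoszM -IHj ?(ltnW j_lt) //.
rewrite -[RHS]mulrA -even_odd_step // -subzn ?(ltnW j_lt) //.
by ring.
Qed.

(** The Lucas coefficient [n / (n - j) * 'C(n - j, j)], in a form without
division. *)
Definition lucas_coef (n j : nat) : nat :=
  ('C(n - j, j) + if j is i.+1 then 'C(n - j.+1, i) else 0)%N.

Lemma lucas_coef_ffact (n j : nat) : (0 < n)%N -> (j <= n %/ 2)%N ->
  (n ^_ j.*2 = j`! * ((n.-1) ^_ j * lucas_coef n j))%N.
Proof.
move=> n_gt0; case: j => [|j] j_le; rewrite /lucas_coef.
  by rewrite !ffactn0 bin0.
have -> : (n - j.+1 = (n - j.+2).+1)%N by lia.
rewrite mulnCA mulnDr [(j.+1`! * _)%N]mulnC bin_ffact factS -mulnA.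
rewrite [(j`! * _)%N]mulnC bin_ffact ffactSS -mulnDl.
have -> : ((n - j.+2).+1 + j.+1 = n)%N by lia.
have -> : (j.+1.*2 = (j.+1 + j).+1)%N by lia.
rewrite -[in LHS](prednK n_gt0) ffactSS prednK //.
have -> : (n - j.+2 = n.-1 - j.+1)%N by lia.
have split_ffact m p q : (m ^_ (p + q) = m ^_ p * (m - p) ^_ q)%N.
  elim: q => [|q IHq]; first by rewrite addn0 ffactn0 muln1.
  by rewrite addnS !ffactnSr IHq subnDA mulnA.
by rewrite split_ffact mulnCA.
Qed.

(** Both sides, multiplied by [j`!], are [n ^_ (2 j)]. *)
Lemma lucas_coef_bin (n j : nat) : (0 < n)%N -> (j <= n %/ 2)%N ->
  2 ^+ j * 'C(n %/ 2, j)%:Z *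
    \prod_(0 <= i < j) (n%:Z - 2 * i%:Z - (delta n.-1)%:Z) =
  ((n.-1) ^_ j)%:Z * (lucas_coef n j)%:Z.
Proof.
move=> n_gt0 j_le.
have fact_neq0 : (j`!)%:Z != 0 by rewrite eqz_nat -lt0n fact_gt0.
apply: (mulfI fact_neq0); rewrite -!PoszM -lucas_coef_ffact // -even_odd_ffact //.
by rewrite -bin_ffact PoszM; ring.
Qed.

Lemma ffact_int_prod (n j : nat) : (0 < n)%N -> (j < n)%N ->
  ((n.-1) ^_ j)%:Z = \prod_(0 <= i < j) (n%:Z - i.+1%:Z).
Proof.
move=> n_gt0; elim: j => [|j IHj] j_lt; first by rewrite big_geq.
rewrite big_nat_recr //= ffactnSr PoszM IHj ?(ltnW j_lt) //.
by congr (_ * _); lia.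
Qed.

Lemma V_lucas_sum (n : nat) : (0 < n)%N ->
  V n 0 (n %/ 2) = (\prod_(0 <= i < n %/ 2) (n%:Z - i.+1%:Z)) *
    \sum_(j < (n %/ 2).+1)
      (-1) ^+ j * 2 ^+ (n %/ 2 - j) * (lucas_coef n j)%:Z.
Proof.
move=> n_gt0.
pose a s : int := 2 * (n%:Z - s%:Z).
pose b r : int := -1 * 2 * (n%:Z - 2 * r%:Z - (delta n.-1)%:Z).
rewrite (@path_sum _ a b (V n)) //; last first.
  by move=> r k; rewrite /a /b /= PoszD; ring.
rewrite mulr_sumr; apply: eq_bigr => j _.
have j_le : (j <= n %/ 2)%N by rewrite -ltnS.
have j_lt : (j < n)%N by lia.
rewrite [in RHS](big_cat_nat _ j_le) //= -ffact_int_prod //.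
rewrite /a /b !big_split /= !prodr_const_nat subn0.
rewrite -mulr_natr natz.
transitivity ((-1) ^+ j * 2 ^+ (n %/ 2 - j) *
  (((n.-1) ^_ j)%:Z * (lucas_coef n j)%:Z) *
  \prod_(j <= i < n %/ 2) (n%:Z - i.+1%:Z)); last by ring.
by rewrite -lucas_coef_bin //; ring.
Qed.

(** * The Fibonacci companion and its period *)

(** [(x ^ (n + 1) - y ^ (n + 1)) / (x - y)] for [x y = 1], [(x + y) ^ 2 = 2],
divided by [x + y] for odd [n]. *)
Definition fib2 (n : nat) : int :=
  \sum_(j < (n %/ 2).+1) (-1) ^+ j * 2 ^+ (n %/ 2 - j) * 'C(n - j, j)%:Z.

(** Pascal's rule.  The factor 2 for even [n] comes from [n + 2] and [n + 1]
having different halves. *)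
Lemma fib2_rec (n : nat) :
  fib2 n.+2 = (if odd n then 1 else 2) * fib2 n.+1 - fib2 n.
Proof.
set k := (n %/ 2)%N.
have halfS2 : (n.+2 %/ 2 = k.+1)%N by rewrite /k; lia.
have pascal : fib2 n.+2 =
    \sum_(j < k.+2) (-1) ^+ j * 2 ^+ (k.+1 - j) * 'C(n.+1 - j, j)%:Z - fib2 n.
  rewrite /fib2 halfS2 -/k big_ord_recl [X in _ = X - _]big_ord_recl /= !bin0.
  rewrite -addrA -sumrB; congr (_ + _); apply: eq_bigr => j _.
  have j_le : (j <= n)%N by have := ltn_ord j; rewrite /k; lia.
  rewrite /bump /= add1n !subSS subSn // binS PoszD exprS.
  by ring.
rewrite pascal; congr (_ - _); rewrite /fib2.
case: ifP => n_odd.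
  by have -> : (n.+1 %/ 2 = k.+1)%N; [rewrite /k; lia | rewrite mul1r].
have -> : (n.+1 %/ 2 = k)%N by rewrite /k; lia.
rewrite big_ord_recr /= bin_small; last by rewrite /k; lia.
rewrite mulr0 addr0 mulr_sumr; apply: eq_bigr => j _.
by rewrite subSn -1?ltnS // exprS; ring.
Qed.

Lemma fib2_add4 (n : nat) : fib2 n.+4 = - fib2 n.
Proof.
rewrite (fib2_rec n.+2) (fib2_rec n.+1) (fib2_rec n) /=.
by case: (odd n) => /=; ring.
Qed.

Lemma fib2_mod8 (n : nat) : fib2 n = fib2 (n %% 8).
Proof.
rewrite {1}(divn_eq n 8); elim: (n %/ 8)%N => [|m IHm]; first by [].
have -> : (m.+1 * 8 + n %% 8 = (m * 8 + n %% 8).+4.+4)%N by lia.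
by rewrite !fib2_add4 opprK.
Qed.

(** The second binomials of [lucas_coef] sum to [- fib2 (n - 2)], which is
[fib2 (n + 2)]; the latter form also covers [n = 1]. *)
Lemma lucas_sum_fib2 (n : nat) : (0 < n)%N ->
  \sum_(j < (n %/ 2).+1) (-1) ^+ j * 2 ^+ (n %/ 2 - j) * (lucas_coef n j)%:Z =
  fib2 n + fib2 n.+2.
Proof.
case: n => [//|[_|n _]].
  by rewrite /fib2 !big_ord_recl !big_ord0.
rewrite fib2_add4 /lucas_coef.
under eq_bigr do rewrite PoszD mulrDr.
rewrite big_split /=; congr (_ + _).
have -> : (n.+2 %/ 2 = (n %/ 2).+1)%N by lia.
rewrite big_ord_recl /= mulr0 add0r /fib2 -sumrN; apply: eq_bigr => j _.
by rewrite /bump /= add1n !subSS exprS; ring.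
Qed.

(** * The quotient *)

Lemma quotient_fib2 (n : nat) : (0 < n)%N ->
  (V n 0 (n %/ 2))%:~R / \prod_(1 <= j < (n %/ 2).+1) (n%:R - j%:R) =
  (fib2 (n %% 8) + fib2 (n.+2 %% 8))%:~R :> rat.
Proof.
move=> n_gt0; rewrite V_lucas_sum // lucas_sum_fib2 // -!fib2_mod8.
rewrite rmorphM /= rmorph_prod /= big_add1 /=.
under eq_bigr do rewrite rmorphB /=.
rewrite mulrAC divff ?mul1r // prodf_seq_neq0.
apply/allP => j; rewrite mem_index_iota /= => j_lt.
by rewrite subr_eq0 Num.Theory.eqr_nat; lia.
Qed.

Theorem theorem4 (n : nat) (n_gt0 : (0 < n)%N) :
  let q : rat :=
    (V n 0 (n %/ 2))%:~R / \prod_(1 <= j < (n %/ 2).+1) (n%:R - j%:R) in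
  [/\ (n%:Z = 0 %[mod 8])%Z -> q = 2,
      (n%:Z = 1 %[mod 8])%Z \/ (n%:Z = - 1 %[mod 8])%Z -> q = 1,
      (n%:Z = 2 %[mod 8])%Z \/ (n%:Z = - 2 %[mod 8])%Z -> q = 0,
      (n%:Z = 3 %[mod 8])%Z \/ (n%:Z = - 3 %[mod 8])%Z -> q = - 1
    & (n%:Z = 4 %[mod 8])%Z \/ (n%:Z = - 4 %[mod 8])%Z -> q = - 2].
Proof.
move=> q; rewrite /q quotient_fib2 //.
have f0 : fib2 0 = 1 by rewrite /fib2 !big_ord_recl big_ord0.
have f1 : fib2 1 = 1 by rewrite /fib2 !big_ord_recl big_ord0.
have f2 : fib2 2 = 1 by rewrite fib2_rec f0 f1.
have f3 : fib2 3 = 0 by rewrite fib2_rec f1 f2.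
have values (r : nat) (x : rat) :
    (n %% 8 = r)%N -> (fib2 r + fib2 (r.+2 %% 8))%:~R = x ->
  (fib2 (n %% 8) + fib2 (n.+2 %% 8))%:~R = x.
  move=> <- <-; have -> : (n.+2 %% 8 = (n %% 8).+2 %% 8)%N by lia.
  by [].
split=> [h | [] h | [] h | [] h | [] h].
- by apply: (values 0); [lia | rewrite /= f0 f2].
- by apply: (values 1); [lia | rewrite /= f1 f3].
- by apply: (values 7); [lia | rewrite /= fib2_add4 f3 f1].
- by apply: (values 2); [lia | rewrite /= fib2_add4 f0 f2].
- by apply: (values 6); [lia | rewrite /= fib2_add4 f0 f2].
- by apply: (values 3); [lia | rewrite /= fib2_add4 f1 f3].
- by apply: (values 5); [lia | rewrite /= !fib2_add4 f1 f3].
- by apply: (values 4); [lia | rewrite /= !fib2_add4 f0 f2].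
- by apply: (values 4); [lia | rewrite /= !fib2_add4 f0 f2].
Qed.
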